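(* Consider the exponential case $\ell(y)=y$ (i.e. $k=1$), with $0<c<p$, horizon $T\ge1$, $b_1>0$, $a_1>1$, and set of feasible wholesale prices $W=(0,\infty)$. Then: (a) There exists a unique SMPS $(w^*_t(a),\tilde z^*_t(a,w))_{1\le t\le T}$. Moreover, writing $\tilde z^*_t(a):=\tilde z^*_t(a,w^*_t(a))$, for all $t\le T$ and $a\in A$, $w\in W$: $$w^*_t(a)=\big(p+f^R_{t+1}(a+1)-f^R_{t+1}(a)\big)\left[1-\frac1a+\frac{c}{a\,w^*_t(a)}-\frac{f^M_{t+1}(a+1)-f^M_{t+1}(a)}{a\big(p+f^R_{t+1}(a+1)-f^R_{t+1}(a)\big)}\right]^{a},$$ $$\tilde z^*_t(a,w)=\max\left(\left(\frac{p+f^R_{t+1}(a+1)-f^R_{t+1}(a)}{w}\right)^{1/a}-1,\ 0\right),\qquad \tilde z^*_t(a)=\left(\frac{p+f^R_{t+1}(a+1)-f^R_{t+1}(a)}{w^*_t(a)}\right)^{1/a}-1,$$ and the standardized value functions are $$f^R_t(a)=\sum_{i=0}^{T-t}\Big[p-w^*_{t+i}(a+i)\big(1+(a+i)\tilde z^*_{t+i}(a+i)\big)\Big],\qquad f^M_t(a)=\sum_{i=0}^{T-t}\Big[w^*_{t+i}(a+i)-c\big(1+(a+i)\tilde z^*_{t+i}(a+i)\big)\Big],$$ with $f^R_{T+1}=f^M_{T+1}=0$. (b) There exists a unique MPE $(w^*_t(a,b),q^*_t(a,b,w))_{1\le t\le T}$ of the game, given by $w^*_t(a,b)=w^*_t(a)$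 and $q^*_t(a,b,w)=b\,\tilde z^*_t(a,w)$.
   Context: Setting. A manufacturer M and a retailer R interact over periods $t=1,\dots,T$. Retail price $p$ and unit cost $c$ satisfy $0<c<p$. Wholesale prices lie in $W=(0,\infty)$; order quantities in $Q=[0,\infty)$. An unknown $\Theta>0$ has Gamma prior density $\phi(\theta\mid a,b)=b^{a}\theta^{a-1}e^{-b\theta}/\Gamma(a)$; given $\Theta=\theta$ demands are i.i.d. with $P(D_t\le y\mid\theta)=1-e^{-\theta y}$. The predictive distribution function is $G(y\mid a,b)=1-\big(b/(b+y)\big)^{a}$, $y\ge0$, $\bar G=1-G$, and $E[\,\cdot\mid a,b]$ is expectation under $D\sim G(\cdot\mid a,b)$. Let $A=\{a_1+n:n=0,1,2,\dots\}$, $B=[b_1,\infty)$. Each period the manufacturer chooses $w$, the retailer observes it and orders $q$, sales $\min(D,q)$ are publicly observed (unmet demand lost, unobserved), and the public belief state moves to $\Phi(a,b,q,d)=(a+\mathbf 1\{\min(d,q)<q\},\ b+\min(d,q))$. Per-period payoffs: $\Pi^R(w,q\mid a,b)=p\,E[\min(D,q)\mid a,b]-wq$, $\Pi^M(w,q)=(w-c)q$. MPE: Markov strategies are Borel maps $w_t:A\times B\to W$, $q_t:A\times B\times W\to Q$. A pair $(w^*_t,q^*_t)_{t\le T}$ is an MPE if there exist $V^R_t,V^M_t:A\times B\to\mathbb R$, $\hat V^R_t:A\times B\times W\to\mathbb R$ ($t\le T+1$) with, for all $a,b,w$: (i) all equal $0$ at $t=T+1$; (ii) $\hat V^R_t(a,b,w)=\max_{q\in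 Q}\{\Pi^R(w,q\mid a,b)+E[V^R_{t+1}(\Phi(a,b,q,D))\mid a,b]\}$, attained at $q^*_t(a,b,w)$; (iii) $V^M_t(a,b)=\max_{w\in W}\{\Pi^M(w,q^*_t(a,b,w))+E[V^M_{t+1}(\Phi(a,b,q^*_t(a,b,w),D))\mid a,b]\}$, attained at $w^*_t(a,b)$; (iv) $V^R_t(a,b)=\hat V^R_t(a,b,w^*_t(a,b))$. SMPS: with $\tilde Q=[0,\infty)$, standardized payoffs $\tilde\Pi^R(w,\tilde z\mid a)=(a-1)(p\,E[\min(D,\tilde z)\mid a,1]-w\tilde z)$, $\tilde\Pi^M(w,\tilde z\mid a)=(a-1)(w-c)\tilde z$, and for $f:A\to\mathbb R$ the operator $\mathcal E[f,\tilde z\mid a]=G(\tilde z\mid a-1,1)f(a+1)+\bar G(\tilde z\mid a-1,1)f(a)$. Standardized Markov strategies are maps $w_t:A\to W$, $\tilde z_t:A\times W\to\tilde Q$. A pair $(w^*_t,\tilde z^*_t)_{t\le T}$ is an SMPS if there exist $f^R_t,f^M_t:A\to\mathbb R$, $\hat f^R_t:A\times W\to\mathbb R$ ($t\le T+1$) with, for all $a,w$: (i) all equal $0$ at $t=T+1$; (ii) $\hat f^R_t(a,w)=\max_{\tilde z\in\tilde Q}\{\tilde\Pi^R(w,\tilde z\mid a)+\mathcal E[f^R_{t+1},\tilde z\mid a]\}$, attained at $\tilde z^*_t(a,w)$; (iii) $f^M_t(a)=\max_{w\in W}\{\tilde\Pi^M(w,\tilde z^*_t(a,w)\mid a)+\mathcal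 E[f^M_{t+1},\tilde z^*_t(a,w)\mid a]\}$, attained at $w^*_t(a)$; (iv) $f^R_t(a)=\hat f^R_t(a,w^*_t(a))$. *)

(* Defs.v *)
From HB Require Import structures.
From mathcomp Require Import all_boot all_order all_algebra.
From mathcomp Require Import all_classical all_reals all_analysis.
Set Implicit Arguments. Unset Strict Implicit. Unset Printing Implicit Defensive.
Import Order.TTheory GRing.Theory Num.Theory.
Import numFieldNormedType.Exports.
Local Open Scope classical_set_scope.
Local Open Scope ring_scope.

Section Model.
Context {R : realType}.

Definition inA (a1 a : R) : Prop := exists n : nat, a = a1 + n%:R.
Definition inB (b1 b : R) : Prop := b1 <= b.
Definition inW (w : R) : Prop := 0 < w.
Definition inQ (q : R) : Prop := 0 <= q.

Definition Gcdf (a b y : R) : R := 1 - (b / (b + y)) `^ a.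
Definition Gbar (a b y : R) : R := 1 - Gcdf a b y.
Definition gpdf (a b y : R) : R := a * b `^ a / (b + y) `^ (a + 1).

Definition Epred (a b : R) (h : R -> R) : R :=
  Rintegral lebesgue_measure `[0%R, +oo[%classic (fun y => h y * gpdf a b y).
Definition Eexists (a b : R) (h : R -> R) : Prop :=
  (@lebesgue_measure R).-integrable `[0%R, +oo[%classic
     (fun y => (h y * gpdf a b y)%:E).

Definition Phi (a b q d : R) : R * R :=
  (a + (if Num.min d q < q then 1 else 0), b + Num.min d q).

Definition VPhi (V : R -> R -> R) (a b q : R) : R -> R :=
  fun y => V (Phi a b q y).1 (Phi a b q y).2.

Definition PiR (p : R) (a b w q : R) : R :=
  p * Epred a b (fun y => Num.min y q) - w * q.
Definition PiM (c : R) (w q : R) : R := (w - c) * q.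

Definition PiRt (p : R) (a w z : R) : R :=
  (a - 1) * (p * Epred a 1 (fun y => Num.min y z) - w * z).
Definition PiMt (c : R) (a w z : R) : R := (a - 1) * (w - c) * z.
Definition Eop (f : R -> R) (a z : R) : R :=
  Gcdf (a - 1) 1 z * f (a + 1) + Gbar (a - 1) 1 z * f a.

Definition is_max (S : set R) (F : R -> R) (x v : R) : Prop :=
  [/\ S x, v = F x & forall y, S y -> F y <= v].

Definition SMPS_with (T : nat) (p c a1 : R)
    (w : nat -> R -> R) (z : nat -> R -> R -> R)
    (fR fM : nat -> R -> R) (fRh : nat -> R -> R -> R) : Prop :=
  [/\ (forall a w0, inA a1 a -> inW w0 ->
         [/\ fR T.+1 a = 0, fM T.+1 a = 0 & fRh T.+1 a w0 = 0]),
      (forall t a w0, (1 <= t <= T)%N -> inA a1 a -> inW w0 ->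
         is_max inQ (fun z0 => PiRt p a w0 z0 + Eop (fR t.+1) a z0)
           (z t a w0) (fRh t a w0)),
      (forall t a, (1 <= t <= T)%N -> inA a1 a ->
         is_max inW (fun w0 => PiMt c a w0 (z t a w0) + Eop (fM t.+1) a (z t a w0))
           (w t a) (fM t a)) &
      (forall t a, (1 <= t <= T)%N -> inA a1 a -> fR t a = fRh t a (w t a))].

Definition SMPS (T : nat) (p c a1 : R)
    (w : nat -> R -> R) (z : nat -> R -> R -> R) : Prop :=
  exists (fR fM : nat -> R -> R) (fRh : nat -> R -> R -> R),
    SMPS_with T p c a1 w z fR fM fRh.

(* Markov perfect equilibrium of the game, with witnesses V^R, V^M, \hat V^R.
   Markov strategies are Borel maps (A is discrete, so Borel on A x B means
   Borel in b for each a; Borel on A x B x W means Borel in (b,w) for each a).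
   The expectations occurring in (ii),(iii) are required to exist. *)
Definition MPE_with (T : nat) (p c a1 b1 : R)
    (w : nat -> R -> R -> R) (q : nat -> R -> R -> R -> R)
    (VR VM : nat -> R -> R -> R) (VRh : nat -> R -> R -> R -> R) : Prop :=
  [/\ (forall t a, (1 <= t <= T)%N -> inA a1 a ->
         measurable_fun (inB b1) (w t a) /\
         measurable_fun (inB b1 `*` inW) (fun bw : R * R => q t a bw.1 bw.2)),
      (forall a b w0, inA a1 a -> inB b1 b -> inW w0 ->
         [/\ VR T.+1 a b = 0, VM T.+1 a b = 0 & VRh T.+1 a b w0 = 0]),
      (forall t a b w0, (1 <= t <= T)%N -> inA a1 a -> inB b1 b -> inW w0 ->
         (forall q0, inQ q0 -> Eexists a b (VPhi (VR t.+1) a b q0)) /\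
         is_max inQ
           (fun q0 => PiR p a b w0 q0 + Epred a b (VPhi (VR t.+1) a b q0))
           (q t a b w0) (VRh t a b w0)),
      (forall t a b, (1 <= t <= T)%N -> inA a1 a -> inB b1 b ->
         (forall w0, inW w0 -> Eexists a b (VPhi (VM t.+1) a b (q t a b w0))) /\
         is_max inW
           (fun w0 => PiM c w0 (q t a b w0)
                      + Epred a b (VPhi (VM t.+1) a b (q t a b w0)))
           (w t a b) (VM t a b)) &
      (forall t a b, (1 <= t <= T)%N -> inA a1 a -> inB b1 b ->
         VR t a b = VRh t a b (w t a b))].

Definition MPE (T : nat) (p c a1 b1 : R)
    (w : nat -> R -> R -> R) (q : nat -> R -> R -> R -> R) : Prop :=
  exists (VR VM : nat -> R -> R -> R) (VRh : nat -> R -> R -> R -> R),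
    MPE_with T p c a1 b1 w q VR VM VRh.

End Model.

(* Main.v *)
Require Import Defs.
From HB Require Import structures.
From mathcomp Require Import all_boot all_order all_algebra.
From mathcomp Require Import all_classical all_reals all_analysis.
From mathcomp Require Import measurable_realfun.
From mathcomp Require Import ring lra.
Import Order.TTheory GRing.Theory Num.Theory.
Import numFieldNormedType.Exports.
Local Open Scope ring_scope.
Local Open Scope classical_set_scope.

Set Implicit Arguments.
Unset Strict Implicit.

(**
Write [u = 1 + z], [r = p + f^R(a+1) - f^R(a)] and [m = f^M(a+1) - f^M(a)] for
the continuation values of the next period.  Up to a constant, the retailer
maximises [r (1 - u^(1-a)) - (a-1) w (u-1)], with unique optimum
[u = max ((r/w)^(1/a), 1)].  Substituting [w = r u^(-a)], the manufacturer's
objective is strictly concave in [u^(1-a)], so a root [U > 1] of the first-order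
condition [c u^a = a r / u - (a-1) r + m] is its unique optimum; such a root
exists if [r > 0] and [r + m > c].  These two conditions propagate backwards in
time, because both players gain strictly from trading in the state [a + 1].
Finally, integrating the Pareto predictive density shows that the game at belief
[(a, b)] is the standardized one rescaled by [b] in quantities and by
[b / (a-1)] in payoffs.
*)

(** * Integrals of shifted powers over half-lines and bounded intervals *)

Section PowerTails.
Context {R : realType}.
Notation mu := (@lebesgue_measure R).

Lemma cvg_powR_shift_y (b e : R) : 0 < b -> 0 < e ->
  (b + y) `^ (- e) @[y --> +oo] --> 0.
Proof.
move=> b0 e0; apply/cvgrPdist_le => d d0; near=> x.
have x0 : 0 < x by near: x; exact: nbhs_pinfty_gt.
have hx : d^-1 `^ e^-1 <= b + x.
  by apply: ler_wpDl; [exact: ltW | near: x; exact: nbhs_pinfty_ge].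
rewrite sub0r normrN ger0_norm ?powR_ge0// powRN -[leRHS]invrK.
rewrite lef_pV2 ?posrE ?invr_gt0// ?powR_gt0 ?addr_gt0//.
have -> : d^-1 = (d^-1 `^ e^-1) `^ e.
  by rewrite -powRrM mulVf ?gt_eqF// powRr1// invr_ge0 ltW.
by apply: ge0_ler_powR => //; rewrite ?nnegrE ?powR_ge0 ?addr_ge0 ?ltW.
Unshelve. all: by end_near. Qed.

Lemma is_derive_powR_shift (b e x : R) : 0 < b + x ->
  is_derive x 1 (fun y => (b + y) `^ e) (e * (b + x) `^ (e - 1)).
Proof.
move=> bx.
have h1 : is_derive x 1 (fun y : R => b + y) 1.
  rewrite -[X in is_derive _ _ _ X]add0r.
  exact: (is_deriveD (is_derive_cst b x 1) (is_derive_id x 1)).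
have h2 := is_derive1_powR e bx.
have := is_derive1_comp h2 h1.
by rewrite mulr1.
Qed.

(** The antiderivative [(b + y)^(1-s) / (1-s)] vanishes at infinity because [s > 1], so only the
    endpoint [x] contributes. *)
Lemma powR_tail_integral (b s x : R) : 0 < b -> 1 < s -> 0 <= x ->
  (\int[mu]_(y in `[x, +oo[) ((b + y) `^ (- s))%:E =
   ((b + x) `^ (1 - s) / (s - 1))%:E)%E.
Proof.
move=> b0 s1 x0.
have pos y : x <= y -> 0 < b + y.
  by move=> xy; rewrite ltr_pwDl// (le_trans x0).
have dF y : x <= y -> is_derive y 1 (fun y => (1 - s)^-1 * (b + y) `^ (1 - s))
    ((b + y) `^ (- s)).
  move=> xy.
  have hd := is_derive_powR_shift (1 - s) (pos _ xy).
  apply: is_derive_eq.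
  have -> : 1 - s - 1 = - s by ring.
  by rewrite /GRing.scale /= mulrA mulVf ?mul1r// subr_eq0 lt_eqF.
have cf y : x <= y -> {for y, continuous (fun y => (b + y) `^ (- s))}.
  move=> xy; apply: differentiable_continuous.
  apply/derivable1_diffP.
  by have [] := is_derive_powR_shift (- s) (pos _ xy).
have cF y : x <= y ->
    {for y, continuous (fun y => (1 - s)^-1 * (b + y) `^ (1 - s))}.
  move=> xy; apply: differentiable_continuous.
  by apply/derivable1_diffP; have [] := dF _ xy.
rewrite (@ge0_continuous_FTC2y R _
  (fun y => (1 - s)^-1 * (b + y) `^ (1 - s)) x 0).
- rewrite -EFinB; congr EFin.
  by rewrite sub0r -mulNr -invrN opprB mulrC.
- by move=> y _; exact: powR_ge0.
- apply/continuous_within_itvcyP; split.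
    by move=> y; rewrite in_itv/= andbT => /ltW; exact: cf.
  by apply: cvg_at_right_filter; exact: cf.
- rewrite -[X in _ --> X](mulr0 (1 - s)^-1); apply: cvgMr.
  have -> : 1 - s = - (s - 1) by ring.
  by apply: cvg_powR_shift_y; rewrite ?subr_gt0.
- by move=> y /ltW /dF [].
- by apply: cvg_at_right_filter; exact: cF.
- move=> y; rewrite in_itv/= andbT => /ltW /dF h.
  by rewrite derive1E; exact: derive_val.
Qed.

Lemma powR_tail_integrable (b s x : R) : 0 < b -> 1 < s -> 0 <= x ->
  mu.-integrable `[x, +oo[ (EFin \o (fun y => (b + y) `^ (- s))).
Proof.
move=> b0 s1 x0; apply/integrableP; split.
  apply/measurable_EFinP; apply: measurable_funTS => /=.
  apply: (measurableT_comp (measurable_powR (- s))).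
  exact: measurable_funD.
under eq_integral => y _ do rewrite /= ger0_norm ?powR_ge0//.
by rewrite powR_tail_integral// ltry.
Qed.

Lemma powR_tail_Rintegral (b s x : R) : 0 < b -> 1 < s -> 0 <= x ->
  \int[mu]_(y in `[x, +oo[) (b + y) `^ (- s) = (b + x) `^ (1 - s) / (s - 1).
Proof. by move=> b0 s1 x0; rewrite /Rintegral powR_tail_integral. Qed.

Lemma itv0y_split (q : R) : 0 <= q ->
  `[0%R, +oo[%classic = (`[0%R, q[%classic `|` `[q, +oo[%classic) :> set R.
Proof. by move=> q0; rewrite -itv_bndbnd_setU ?bnd_simp. Qed.

Lemma itv0y_disjoint (q : R) :
  [disjoint `[0%R, q[%classic & `[q, +oo[%classic : set R].
Proof.
apply/disj_setPS => y [/=]; rewrite 2!in_itv/= => /andP[_ yx] /andP[].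
by rewrite leNgt yx.
Qed.

Lemma powR_head_integrable (b s q : R) : 0 < b -> 1 < s -> 0 <= q ->
  mu.-integrable `[0, q[ (EFin \o (fun y => (b + y) `^ (- s))).
Proof.
move=> b0 s1 q0; apply: (@integrableS _ _ _ mu `[0, +oo[) => //.
  by rewrite (itv0y_split q0); exact: subsetUl.
exact: powR_tail_integrable.
Qed.

Lemma powR_head_Rintegral (b s q : R) : 0 < b -> 1 < s -> 0 <= q ->
  \int[mu]_(y in `[0, q[) (b + y) `^ (- s) =
  (b `^ (1 - s) - (b + q) `^ (1 - s)) / (s - 1).
Proof.
move=> b0 s1 q0.
have := powR_tail_Rintegral b0 s1 (lexx 0).
rewrite (itv0y_split q0) Rintegral_setU//; last 2 first.
  by rewrite -itv0y_split//; exact: powR_tail_integrable.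
  exact: itv0y_disjoint.
rewrite powR_tail_Rintegral// addr0 => /(canRL (addrK _)) ->.
by rewrite -mulrBl.
Qed.

End PowerTails.

(** * Bernoulli inequalities and the optima of the two stage problems *)

Section Optima.
Context {R : realType}.

(** Writes the power as [expR ((1 - a) * ln x)] and combines [1 + s < expR s] for [s != 0] with
    [ln x <= x - 1], reversed by the negative factor [1 - a]. *)
Lemma bernoulli_neg_powR_lt (a x : R) : 1 < a -> 0 < x -> x != 1 ->
  1 + (1 - a) * (x - 1) < x `^ (1 - a).
Proof.
move=> a1 x0 x1; rewrite /powR gt_eqF//.
have lnx0 : (1 - a) * ln x != 0.
  by rewrite mulf_neq0 ?ln_eq0// subr_eq0 lt_eqF.
apply: le_lt_trans (expR_gt1Dx lnx0).
rewrite lerD2l ler_nM2l ?subr_lt0//.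
have := @le_ln1Dx R (x - 1); rewrite [1 + _]addrC subrK; apply.
by rewrite ltrBrDr addNr.
Qed.

Lemma bernoulli_neg_powR_le (a x : R) : 1 < a -> 0 < x ->
  1 + (1 - a) * (x - 1) <= x `^ (1 - a).
Proof.
move=> a1 x0; have [->|x1] := eqVneq x 1.
  by rewrite subrr mulr0 addr0 powR1.
exact/ltW/bernoulli_neg_powR_lt.
Qed.

(** The negative-exponent inequality at [x^-1], multiplied by [x]. *)
Lemma bernoulli_powR_le (a x : R) : 1 < a -> 0 < x ->
  1 + a * (x - 1) <= x `^ a.
Proof.
move=> a1 x0.
have xi : 0 < x^-1 by rewrite invr_gt0.
have := bernoulli_neg_powR_le a1 xi.
rewrite -(ler_pM2l x0).
have -> : x * x^-1 `^ (1 - a) = x `^ a.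
  rewrite -(powR_inv1 (ltW x0)) -powRrM -{1}(powRr1 (ltW x0)) -powRD.
    by congr (_ `^ _); ring.
  by apply/implyP => _; rewrite gt_eqF.
apply: le_trans; rewrite le_eqVlt; apply/orP; left; apply/eqP; field.
by rewrite gt_eqF.
Qed.

Lemma powR1B (a u : R) : 0 < u -> u `^ (1 - a) = u * u `^ (- a).
Proof.
by move=> u0; rewrite powRD ?powRr1 ?ltW//; apply/implyP => _; rewrite gt_eqF.
Qed.

(** Strict convexity of [u^(1-a)] as a tangent-line bound at [v]; it is Bernoulli at [u / v],
    rescaled by [v^(1-a)]. *)
Lemma powR_neg_tangent_lt (a u v : R) : 1 < a -> 0 < u -> 0 < v -> u != v ->
  v `^ (1 - a) + (1 - a) * v `^ (- a) * (u - v) < u `^ (1 - a).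
Proof.
move=> a1 u0 v0 uv.
have uv0 : 0 < u / v by rewrite divr_gt0.
have uv1 : u / v != 1.
  by apply: contra uv => /eqP e; rewrite -[u](divfK (lt0r_neq0 v0)) e mul1r.
have := bernoulli_neg_powR_lt a1 uv0 uv1.
rewrite -(ltr_pM2l (powR_gt0 (1 - a) v0)) -powRM ?ltW//.
have -> : v * (u / v) = u by field; rewrite gt_eqF.
apply: le_lt_trans; rewrite le_eqVlt; apply/orP; left; apply/eqP.
by rewrite powR1B//; field; rewrite gt_eqF.
Qed.

(** The retailer's standardized advantage over not ordering, which is [u = 1]. *)
Definition retailer_gain (a r w u : R) : R :=
  r * (1 - u `^ (1 - a)) - (a - 1) * w * (u - 1).

Definition best_stock (a r w : R) : R := Num.max ((r / w) `^ a^-1) 1.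

Lemma best_stock_ge1 (a r w : R) : 1 <= best_stock a r w.
Proof. by rewrite le_max lexx orbT. Qed.

Lemma powR_rootN (a x : R) : 0 < a -> 0 < x -> (x `^ a^-1) `^ (- a) = x^-1.
Proof.
move=> a0 x0; rewrite -powRrM mulrN mulVf ?gt_eqF// powR_inv1//; exact: ltW.
Qed.

Lemma retailer_gain_lt (a r w u : R) : 1 < a -> 0 < r -> 0 < w -> 1 <= u ->
  u != best_stock a r w ->
  retailer_gain a r w u < retailer_gain a r w (best_stock a r w).
Proof.
move=> a1 r0 w0 u1 une; rewrite /retailer_gain.
have a0 : 0 < a by exact: lt_trans a1.
have u0 : 0 < u by exact: lt_le_trans u1.
have v1 := best_stock_ge1 a r w.
have v0 : 0 < best_stock a r w by exact: lt_le_trans v1.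
(* A variational inequality covers both cases of the maximum: it is an equality at an interior
   optimum, and at the boundary [1] it follows from [r <= w] and [u >= 1]. *)
have foc : r * best_stock a r w `^ (- a) * (u - best_stock a r w)
    <= w * (u - best_stock a r w).
  rewrite /best_stock maxEle; case: ifPn => [h|_]; last first.
    by rewrite powR_rootN ?divr_gt0// invf_div [r * _]mulrC divfK ?gt_eqF.
  rewrite powR1 mulr1 ler_wpM2r ?subr_ge0//.
  have rw0 : 0 <= r / w by rewrite ltW// divr_gt0.
  have := @ge0_ler_powR R a (ltW a0) _ _ _ _ h.
  rewrite !nnegrE powR_ge0 ler01 powR1 -powRrM mulVf ?gt_eqF//.
  rewrite powRr1// => /(_ isT isT).
  by rewrite ler_pdivrMr// mul1r.
have := powR_neg_tangent_lt a1 u0 v0 une.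
rewrite -(ltr_pM2l r0).
move: foc; set v := best_stock a r w; set P := v `^ (1 - a).
set Q := v `^ (- a); set S := u `^ (1 - a).
move: (ltW a1); rewrite -subr_ge0 => b0 foc; move: (ler_wpM2l b0 foc).
lra.
Qed.

(** The manufacturer's advantage over no trade when charging [r u^(-a)], the price that induces the
    stock [u]. *)
Definition maker_gain (a c r m u : R) : R :=
  (a - 1) * (r * u `^ (- a) - c) * (u - 1) + m * (1 - u `^ (1 - a)).

(** The equation is the vanishing of the derivative of [maker_gain], multiplied by
    [u^a / (a - 1)]. *)
Definition maker_foc (a c r m u : R) : Prop :=
  1 < u /\ c * u `^ a = a * r / u - (a - 1) * r + m.

(* In the variable u^(1-a) the gain is strictly concave; the two Bernoulli
   inequalities below are the tangent-line bounds of its two nonlinear terms. *)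
Lemma maker_gain_lt (a c r m U u : R) : 1 < a -> 0 < c -> 0 < r ->
  maker_foc a c r m U -> 0 < u -> u != U ->
  maker_gain a c r m u < maker_gain a c r m U.
Proof.
move=> a1 c0 r0 [U1 foc] u0 uU.
have U0 : 0 < U by exact: lt_trans U1.
have [x [x0 x1 ->]] : exists x, [/\ 0 < x, x != 1 & u = U * x].
  exists (u / U); split; [by rewrite divr_gt0| |by rewrite mulrC divfK ?gt_eqF].
  by apply: contra uU => /eqP e; rewrite -[u](divfK (lt0r_neq0 U0)) e mul1r.
have := bernoulli_neg_powR_lt a1 x0 x1.
have := bernoulli_powR_le a1 x0.
have U0' := ltW U0; have x0' := ltW x0.
rewrite /maker_gain !powR1B ?mulr_gt0// !powRM// => e2 e1.
have xa : 0 < x `^ a by exact: powR_gt0.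
have {}e2 : x `^ (- a) * (1 + a * (x - 1)) <= 1.
  by rewrite powRN mulrC ler_pdivrMr// mul1r.
have wU : 0 < U `^ (- a) by exact: powR_gt0.
have focw : c = (a * r / U - (a - 1) * r + m) * U `^ (- a).
  rewrite -foc -mulrA -powRD ?subrr ?powRr0 ?mulr1//.
  by apply/implyP => _; rewrite gt_eqF.
(* Once [m] is eliminated by the first-order condition, the gap between the gains at [U] and at
   [U * x] is exactly the sum of the two products in [h1] and [h2]. *)
have mE : m * (U * U `^ (- a)) =
    c * U - a * (r * U `^ (- a)) + (a - 1) * (r * U `^ (- a)) * U.
  by rewrite [in RHS]focw; field; rewrite gt_eqF.
have cU : 0 < c * U by rewrite mulr_gt0.
have rW : 0 < r * U `^ (- a) by rewrite mulr_gt0.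
move: mE e1 e2 cU rW; set W := U `^ (- a); set X := x `^ (- a).
move=> mE e1 e2 cU rW.
have h1 : 0 < c * U * (x * X - (1 + (1 - a) * (x - 1))).
  by rewrite mulr_gt0// subr_gt0.
have h2 : 0 <= (r * W) * (1 - X * (1 + a * (x - 1))).
  by rewrite mulr_ge0 ?subr_ge0// ltW.
have h3 : (m * (U * W)) * (1 - x * X) =
    (c * U - a * (r * W) + (a - 1) * (r * W) * U) * (1 - x * X) by rewrite mE.
move: h1 h2 h3.
lra.
Qed.

Lemma maker_foc_exists (a c r m : R) : 1 < a -> 0 < c -> 0 < r -> c < r + m ->
  exists U, maker_foc a c r m U.
Proof.
move=> a1 c0 r0 crm.
have a0 : 0 < a by exact: lt_trans a1.
(* [g] is the first-order condition multiplied by [u]. [K] solves [c K = c + r + m], so that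
   bounding [K^a] below by [K] cancels the term in [m] and leaves [g K >= c K + a r (K - 1)]. *)
pose g u := c * u `^ a * u + ((a - 1) * r - m) * u - a * r.
pose K := 1 + (r + m) / c.
have K1 : 1 <= K by rewrite lerDl divr_ge0 ?ltW// (lt_trans c0).
have g1 : g 1 < 0 by rewrite /g powR1; lra.
have gK : 0 <= g K.
  have cK : c * K = c + (r + m) by rewrite /K; field; rewrite gt_eqF.
  have KKa : K <= K `^ a by apply: le1r_powR => //; exact: ltW.
  have h1 : c * K * K <= c * K `^ a * K.
    by rewrite ler_wpM2r ?(le_trans _ K1)// ler_wpM2l// ltW.
  have h2 : 0 <= a * r * (K - 1) by rewrite !mulr_ge0 ?subr_ge0// ltW.
  have h3 : 0 <= c * K by rewrite mulr_ge0 ?(le_trans _ K1)// ltW.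
  have h4 : c * K * K = (c + (r + m)) * K by rewrite cK.
  rewrite /g; move: h1 h2 h3 h4; lra.
have cg : {within `[1, K], continuous g}.
  apply: continuous_in_subspaceT => u; rewrite inE/= in_itv/= => /andP[u1 _].
  have u0 : 0 < u by exact: lt_le_trans u1.
  apply: differentiable_continuous; apply/derivable1_diffP.
  have := is_derive1_powR a u0.
  by move=> h; apply: ex_derive.
have [|u] := @IVT R g 1 K 0 K1 cg.
  by rewrite ge_min le_max (ltW g1) gK orbT.
rewrite in_itv/= => /andP[u1 _] gu.
have u1' : 1 < u.
  rewrite lt_neqAle u1 andbT; apply/eqP => e.
  by move: g1; rewrite e gu ltxx.
have u0 : u != 0 by rewrite gt_eqF// (lt_trans _ u1').
exists u; split => //; apply: (mulIf u0).
rewrite mulrDl mulrBl divfK//; move: gu; rewrite /g; lra.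
Qed.

End Optima.

(** * Expectations under the Pareto predictive density *)

Section Expectation.
Context {R : realType}.
Notation mu := (@lebesgue_measure R).

Lemma integrable_setU {d} {X : measurableType d}
    (nu : {measure set X -> \bar R}) (A B : set X) (f : X -> \bar R) :
  measurable A -> measurable B -> [disjoint A & B] ->
  nu.-integrable A f -> nu.-integrable B f -> nu.-integrable (A `|` B) f.
Proof.
move=> mA mB AB /integrableP[mfA fA] /integrableP[mfB fB].
have mf : measurable_fun (A `|` B) f by apply/measurable_funU.
apply/integrableP; split => //.
rewrite ge0_integral_setU//; first by rewrite lte_add_pinfty.
exact: measurableT_comp.
Qed.

Lemma gpdfE (a b y : R) : gpdf a b y = a * b `^ a * (b + y) `^ (- (a + 1)).
Proof. by rewrite /gpdf powRN. Qed.

Lemma powR_ratio (b q e : R) : 0 < b -> 0 <= q ->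
  b `^ e * (b + q) `^ (- e) = (b / (b + q)) `^ e.
Proof.
move=> b0 q0; have bq : 0 < b + q by rewrite ltr_wpDr.
rewrite powRM ?invr_ge0 ?ltW//; congr (_ * _).
by rewrite -(powR_inv1 (ltW bq)) -powRrM mulN1r.
Qed.

Section Piecewise.
Variables (a b q al be k : R) (h : R -> R).
Hypotheses (a1 : 1 < a) (b0 : 0 < b) (q0 : 0 <= q).
Hypothesis hE : forall y, 0 <= y ->
  h y = if y < q then al * (b + y) + be else k.

Let headE y : y \in (`[0, q[%classic : set R) ->
  h y * gpdf a b y = al * (a * b `^ a) * (b + y) `^ (- a) +
                     be * (a * b `^ a) * (b + y) `^ (- (a + 1)).
Proof.
rewrite inE/= in_itv/= => /andP[y0 yq]; rewrite hE// yq gpdfE.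
have by0 : 0 < b + y by rewrite ltr_wpDr.
have -> : (b + y) `^ (- a) = (b + y) * (b + y) `^ (- (a + 1)).
  rewrite -{2}(powRr1 (ltW by0)) -powRD; first by congr (_ `^ _); ring.
  by apply/implyP => _; rewrite gt_eqF.
ring.
Qed.

Let tailE y : y \in (`[q, +oo[%classic : set R) ->
  h y * gpdf a b y = k * (a * b `^ a) * (b + y) `^ (- (a + 1)).
Proof.
rewrite inE/= in_itv/= andbT => yq; rewrite hE ?(le_trans q0)//.
by rewrite ltNge yq/= gpdfE mulrA.
Qed.

Let a1' : 1 < a + 1. Proof. by rewrite ltrDr (lt_trans _ a1). Qed.

Let integrableMl (D : set (measurableTypeR R)) (f : R -> R) (x : R) : measurable D ->
  mu.-integrable D (EFin \o f) -> mu.-integrable D (EFin \o (fun y => x * f y)).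
Proof.
move=> mD fD.
have := integrableZl mD x fD.
by apply: eq_integrable => // y _ /=; rewrite EFinM.
Qed.

Let head_integrable :
  mu.-integrable `[0, q[ (EFin \o (fun y => h y * gpdf a b y)).
Proof.
have m : measurable (`[0, q[%classic : set (measurableTypeR R)) by [].
have := integrableD m
  (integrableMl (al * (a * b `^ a)) m (powR_head_integrable b0 a1 q0))
  (integrableMl (be * (a * b `^ a)) m (powR_head_integrable b0 a1' q0)).
by apply: eq_integrable => // y yq /=; rewrite headE// EFinD.
Qed.

Let tail_integrable :
  mu.-integrable `[q, +oo[ (EFin \o (fun y => h y * gpdf a b y)).
Proof.
have m : measurable (`[q, +oo[%classic : set (measurableTypeR R)) by [].
have := integrableMl (k * (a * b `^ a)) m (powR_tail_integrable b0 a1' q0).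
by apply: eq_integrable => // y yq /=; rewrite tailE.
Qed.

Lemma Eexists_piecewise : Eexists a b h.
Proof.
rewrite /Eexists (itv0y_split q0); apply: integrable_setU => //.
exact: itv0y_disjoint.
Qed.

(** Both sales and continuation values are affine in [b + y] below the order and constant above it,
    so one formula serves them all. The factor [b + y] lowers the exponent of the density by one,
    whence the power [a - 1]. *)
Lemma Epred_piecewise : Epred a b h =
  al * a * b / (a - 1) * (1 - (b / (b + q)) `^ (a - 1)) +
  be * (1 - (b / (b + q)) `^ a) + k * (b / (b + q)) `^ a.
Proof.
have m1 : measurable (`[0, q[%classic : set (measurableTypeR R)) by [].
have m2 : measurable (`[q, +oo[%classic : set (measurableTypeR R)) by [].
rewrite /Epred (itv0y_split q0) Rintegral_setU//; last 2 first.
  by rewrite -itv0y_split//; exact: Eexists_piecewise.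
  exact: itv0y_disjoint.
rewrite (@eq_Rintegral _ _ _ mu _ _ _ headE).
rewrite (@eq_Rintegral _ _ _ mu _ _ _ tailE).
have i1 := powR_head_integrable b0 a1 q0.
have i2 := powR_head_integrable b0 a1' q0.
have i3 := powR_tail_integrable b0 a1' q0.
rewrite RintegralD//; try exact: integrableMl.
rewrite !RintegralZl// !powR_head_Rintegral// powR_tail_Rintegral//.
have -> : 1 - (a + 1) = - a by ring.
have -> : 1 - a = - (a - 1) by ring.
rewrite -!powR_ratio//.
have e3 : b `^ a = b * b `^ (a - 1).
  by rewrite mulr_powRB1 ?ltW// (lt_trans _ a1).
have a0 : a != 0 by rewrite gt_eqF// (lt_trans _ a1).
have a10 : a - 1 != 0 by rewrite subr_eq0 gt_eqF.
have -> : b `^ (- a) = (b `^ a)^-1 by rewrite powRN.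
have -> : b `^ (- (a - 1)) = (b `^ (a - 1))^-1 by rewrite powRN.
have B0 : b `^ (a - 1) != 0 by rewrite gt_eqF// powR_gt0.
rewrite e3.
field.
by rewrite a10 B0 addrK a0 gt_eqF.
Qed.

End Piecewise.

Lemma Epred_min (a b q : R) : 1 < a -> 0 < b -> 0 <= q ->
  Epred a b (fun y => Num.min y q) =
  b / (a - 1) * (1 - (b / (b + q)) `^ (a - 1)).
Proof.
move=> a1 b0 q0; rewrite (@Epred_piecewise a b q 1 (- b) q)//; last first.
  by move=> y _; rewrite /Order.min; case: ifP => // _; ring.
have bq : 0 < b + q by rewrite ltr_wpDr.
have s0 : 0 < b / (b + q) by rewrite divr_gt0.
have -> : (b / (b + q)) `^ a = b / (b + q) * (b / (b + q)) `^ (a - 1).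
  by rewrite mulr_powRB1 ?ltW// (lt_trans _ a1).
have a10 : a - 1 != 0 by rewrite subr_eq0 gt_eqF.
have bq0 : b + q != 0 by rewrite gt_eqF.
by field; rewrite bq0 a10.
Qed.

Lemma VPhi_lt (V : R -> R -> R) (a b q y : R) : y < q ->
  VPhi V a b q y = V (a + 1) (b + y).
Proof. by move=> yq; rewrite /VPhi /Phi/= /Order.min yq yq. Qed.

Lemma VPhi_ge (V : R -> R -> R) (a b q y : R) : q <= y ->
  VPhi V a b q y = V a (b + q).
Proof.
by move=> qy; rewrite /VPhi /Phi/= min_r// ltxx addr0.
Qed.

Section ScaledContinuation.
Variables (a b q : R) (f : R -> R) (V : R -> R -> R).
Hypotheses (a1 : 1 < a) (b0 : 0 < b) (q0 : 0 <= q).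
Hypothesis V0 : forall x, b <= x -> V a x = x / (a - 1) * f a.
Hypothesis V1 : forall x, b <= x -> V (a + 1) x = x / a * f (a + 1).

Let VE y : 0 <= y -> VPhi V a b q y =
  if y < q then f (a + 1) / a * (b + y) + 0 else (b + q) / (a - 1) * f a.
Proof.
move=> y0; case: ltP => yq.
  by rewrite VPhi_lt// V1 ?lerDl// addr0; ring.
by rewrite VPhi_ge// V0// lerDl.
Qed.

Lemma Eexists_VPhi : Eexists a b (VPhi V a b q).
Proof. exact: (Eexists_piecewise a1 b0 q0 VE). Qed.

(** An uncensored demand leads to the value [(b + y) f(a+1) / a]; weighting the Pareto density of
    index [a] by [b + y] turns it into one of index [a - 1]. This is why [Eop] uses the distribution
    function with parameter [a - 1]. *)
Lemma Epred_VPhi :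
  Epred a b (VPhi V a b q) = b / (a - 1) * Eop f a (q / b).
Proof.
rewrite (Epred_piecewise a1 b0 q0 VE) /Eop /Gbar /Gcdf.
have bq : 0 < b + q by rewrite ltr_wpDr.
have s0 : 0 < b / (b + q) by rewrite divr_gt0.
have -> : 1 / (1 + q / b) = b / (b + q).
  by field; rewrite !gt_eqF// addrC.
have -> : (b / (b + q)) `^ a = b / (b + q) * (b / (b + q)) `^ (a - 1).
  by rewrite mulr_powRB1 ?ltW// (lt_trans _ a1).
have a10 : a - 1 != 0 by rewrite subr_eq0 gt_eqF.
have a00 : a != 0 by rewrite gt_eqF// (lt_trans _ a1).
have bq0 : b + q != 0 by rewrite gt_eqF.
by field; rewrite bq0 a10 a00.
Qed.

End ScaledContinuation.
End Expectation.

(** * One stage of the standardized game *)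

Section Stage.
Context {R : realType}.
Variables (p c : R).
Hypotheses (c0 : 0 < c).

(** Strictness packages existence and uniqueness of the maximiser, so each stage is solved once for
    both halves of the theorem. *)
Definition strict_max (S : set R) (F : R -> R) (x : R) : Prop :=
  S x /\ forall y, S y -> y != x -> F y < F x.

Lemma strict_max_is_max (S : set R) F x : strict_max S F x -> is_max S F x (F x).
Proof.
move=> [Sx lt]; split => // y Sy.
by have [->//|yx] := eqVneq y x; exact/ltW/lt.
Qed.

Lemma strict_max_uniq (S : set R) F x x' v : strict_max S F x ->
  is_max S F x' v -> x' = x /\ v = F x.
Proof.
move=> [Sx lt] [Sx' -> le].
suff e : x' = x by rewrite e.
apply/eqP; apply: contraT => /(lt _ Sx').
by rewrite ltNge le.
Qed.

Lemma strict_max_scale (S : set R) (F G : R -> R) (x k b : R) :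
  0 < k -> 0 < b -> (forall y, S y -> S (b * y) /\ S (y / b)) ->
  (forall y, S y -> G y = k * F (y / b)) ->
  strict_max S F x -> strict_max S G (b * x).
Proof.
move=> k0 b0 hS hG [Sx lt]; split; first by have [] := hS _ Sx.
have bn : b != 0 by rewrite gt_eqF.
move=> y Sy yx; rewrite !hG//; last by have [] := hS _ Sx.
rewrite [b * x]mulrC mulfK// ltr_pM2l//; apply: lt; first by have [] := hS _ Sy.
by apply: contra yx => /eqP <-; rewrite mulrC divfK.
Qed.

(** The factor [u - 1] keeps the inverse demand [w = r u^(-a)] usable when the order is zero: both
    sides then vanish. *)
Lemma best_stock_price (a r w : R) : 1 < a -> 0 < r -> 0 < w ->
  w * (best_stock a r w - 1) =
  r * best_stock a r w `^ (- a) * (best_stock a r w - 1).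
Proof.
move=> a1 r0 w0; have a0 : 0 < a by exact: lt_trans a1.
rewrite /best_stock maxEle; case: ifPn => [_|_]; first by rewrite subrr !mulr0.
by rewrite powR_rootN ?divr_gt0// invf_div (mulrC r (w / r)) divfK ?gt_eqF.
Qed.

Lemma best_stock_eq (a r w U : R) : 1 < a -> 0 < r -> 0 < w -> 1 < U ->
  best_stock a r w = U -> w = r * U `^ (- a).
Proof.
move=> a1 r0 w0 U1 e; have := best_stock_price a1 r0 w0; rewrite e.
by apply: mulIf; rewrite subr_eq0 gt_eqF.
Qed.

Lemma best_stock_at_price (a r U : R) : 1 < a -> 0 < r -> 1 < U ->
  (r / (r * U `^ (- a))) `^ a^-1 = U /\ best_stock a r (r * U `^ (- a)) = U.
Proof.
move=> a1 r0 U1; have a0 : 0 < a by exact: lt_trans a1.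
have U0 : 0 < U by exact: lt_trans U1.
have e : (r / (r * U `^ (- a))) `^ a^-1 = U.
  rewrite invfM mulrA divff ?gt_eqF// mul1r powRN invrK.
  by rewrite -powRrM divff ?gt_eqF// powRr1// ltW.
by rewrite /best_stock e; split => //; apply/max_idPl/ltW.
Qed.

Lemma retailer_objective (a w z : R) (f : R -> R) : 1 < a -> 0 <= z ->
  PiRt p a w z + Eop f a z =
  f a + retailer_gain a (p + f (a + 1) - f a) w (1 + z).
Proof.
move=> a1 z0; rewrite /PiRt /Eop /Gbar /Gcdf /retailer_gain Epred_min//.
have -> : (1 / (1 + z)) `^ (a - 1) = (1 + z) `^ (1 - a).
  rewrite mul1r -(@powR_inv1 _ (1 + z)) ?addr_ge0// -powRrM.
  by congr (_ `^ _); ring.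
field.
by rewrite subr_eq0 gt_eqF.
Qed.

Lemma maker_objective (a w : R) (r : R) (f : R -> R) :
  1 < a -> 0 < r -> 0 < w ->
  PiMt c a w (best_stock a r w - 1) + Eop f a (best_stock a r w - 1) =
  f a + maker_gain a c r (f (a + 1) - f a) (best_stock a r w).
Proof.
move=> a1 r0 w0; rewrite /PiMt /Eop /Gbar /Gcdf /maker_gain.
have := best_stock_price a1 r0 w0.
have := best_stock_ge1 a r w.
set u := best_stock a r w => u1 e.
have u0 : 0 < u by exact: lt_le_trans u1.
have -> : (1 / (1 + (u - 1))) `^ (a - 1) = u `^ (1 - a).
  rewrite mul1r [1 + _]addrC subrK -(powR_inv1 (ltW u0)) -powRrM.
  by congr (_ `^ _); ring.
have -> : (a - 1) * (w - c) * (u - 1) =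
    (a - 1) * (w * (u - 1)) - (a - 1) * c * (u - 1) by ring.
rewrite e; ring.
Qed.

Lemma retailer_strict_max (a w : R) (f : R -> R) : 1 < a -> 0 < w ->
  0 < p + f (a + 1) - f a ->
  strict_max inQ (fun z => PiRt p a w z + Eop f a z)
    (best_stock a (p + f (a + 1) - f a) w - 1).
Proof.
move=> a1 w0 r0; have u1 := best_stock_ge1 a (p + f (a + 1) - f a) w.
split; first by rewrite /inQ subr_ge0.
move=> z z0 zne; rewrite !retailer_objective ?subr_ge0// ltrD2l.
rewrite [1 + (_ - 1)]addrC subrK; apply: retailer_gain_lt => //.
  by rewrite lerDl.
by apply: contra zne => /eqP <-; rewrite addrC addKr.
Qed.

(** Prices are compared through the stocks they induce. Since [U > 1], only the price [r U^(-a)]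
    induces [U], so any other price yields another stock and a strictly smaller gain. *)
Lemma maker_strict_max (a r U : R) (f : R -> R) (z : R -> R) :
  1 < a -> 0 < r -> maker_foc a c r (f (a + 1) - f a) U ->
  (forall w, inW w -> z w = best_stock a r w - 1) ->
  strict_max inW (fun w => PiMt c a w (z w) + Eop f a (z w)) (r * U `^ (- a)).
Proof.
move=> a1 r0 foc zE; have [U1 _] := foc.
have U0 : 0 < U by exact: lt_trans U1.
have w0 : inW (r * U `^ (- a)) by rewrite /inW mulr_gt0// powR_gt0.
split=> // w w1 wne; rewrite !zE// !maker_objective// ltrD2l.
rewrite (best_stock_at_price a1 r0 U1).2.
apply: maker_gain_lt => //.
  exact: lt_le_trans (best_stock_ge1 _ _ _).
by apply: contra wne => /eqP /(best_stock_eq a1 r0 w1 U1) <-.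
Qed.

(** Brings the stage gain into the shape of the summands of the closed-form value. *)
Lemma retailer_gain_foc (a r U : R) : 1 < U ->
  retailer_gain a r (r * U `^ (- a)) U = r - r * U `^ (- a) * (1 + a * (U - 1)).
Proof.
move=> U1; have U0 : 0 < U by exact: lt_trans U1.
rewrite /retailer_gain powR1B//; ring.
Qed.

Lemma maker_gain_foc (a r m U : R) : maker_foc a c r m U ->
  maker_gain a c r m U = m + (r * U `^ (- a) - c * (1 + a * (U - 1))).
Proof.
move=> [U1 foc]; have U0 : 0 < U by exact: lt_trans U1.
have Ua : U `^ a != 0 by rewrite gt_eqF// powR_gt0.
have -> : c = (a * r / U - (a - 1) * r + m) * U `^ (- a).
  by rewrite -foc powRN mulfK.
rewrite /maker_gain powR1B//; field.
by rewrite gt_eqF.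
Qed.

(** [U] is the strict optimum at this price, and the competing choice [u = 1] has gain zero. *)
Lemma retailer_gain_gt0 (a r U : R) : 1 < a -> 0 < r -> 1 < U ->
  0 < retailer_gain a r (r * U `^ (- a)) U.
Proof.
move=> a1 r0 U1; have U0 : 0 < U by exact: lt_trans U1.
have w0 : 0 < r * U `^ (- a) by rewrite mulr_gt0// powR_gt0.
have := @retailer_gain_lt R a r (r * U `^ (- a)) 1 a1 r0 w0 (lexx _).
rewrite (best_stock_at_price a1 r0 U1).2 lt_eqF// => /(_ isT).
by rewrite {1}/retailer_gain powR1 !subrr !mulr0 subrr.
Qed.

Lemma maker_gain_gt0 (a r m U : R) : 1 < a -> 0 < r -> maker_foc a c r m U ->
  0 < maker_gain a c r m U.
Proof.
move=> a1 r0 foc; have [U1 _] := foc.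
have := maker_gain_lt a1 c0 r0 foc ltr01; rewrite lt_eqF// => /(_ isT).
by rewrite {1}/maker_gain powR1 !subrr !mulr0 addr0.
Qed.

End Stage.

(** * Backward recursion for values, stocks and prices *)

Section Recursion.
Context {R : realType}.
Variables (p c : R).
Hypotheses (c0 : 0 < c) (cp : c < p).

(** Choosing a root with a default makes the recursion total before its solvability is known. The
    default [1] is not itself a root, since [maker_foc] demands [1 < u]. *)
Definition foc_root (a r m : R) : R := xget 1 [set U | maker_foc a c r m U].

Lemma foc_rootP (a r m : R) : 1 < a -> 0 < r -> c < r + m ->
  maker_foc a c r m (foc_root a r m).
Proof.
move=> a1 r0 crm; have [U UP] := maker_foc_exists a1 c0 r0 crm.
exact: (xgetPex 1 (ex_intro _ U UP)).
Qed.

(* [value k a] pairs the retailer's and the manufacturer's standardized values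
   with [k] periods to go. *)
Fixpoint value (k : nat) (a : R) : R * R :=
  if k is k'.+1 then
    let r := p + (value k' (a + 1)).1 - (value k' a).1 in
    let U := foc_root a r ((value k' (a + 1)).2 - (value k' a).2) in
    let w := r * U `^ (- a) in
    ((p - w * (1 + a * (U - 1))) + (value k' (a + 1)).1,
     (w - c * (1 + a * (U - 1))) + (value k' (a + 1)).2)
  else (0, 0).

Definition valueR k a := (value k a).1.
Definition valueM k a := (value k a).2.
(** In [margin], [stock] and [price], [k] counts the periods after the current one, whose own value
    is [value k.+1]. *)
Definition margin k a := p + valueR k (a + 1) - valueR k a.
Definition stock k a := foc_root a (margin k a) (valueM k (a + 1) - valueM k a).
Definition price k a := margin k a * stock k a `^ (- a).

Lemma valueRS k a : valueR k.+1 a =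
  (p - price k a * (1 + a * (stock k a - 1))) + valueR k (a + 1).
Proof. by []. Qed.

Lemma valueMS k a : valueM k.+1 a =
  (price k a - c * (1 + a * (stock k a - 1))) + valueM k (a + 1).
Proof. by []. Qed.

(* Positivity of the two gains at [a + 1] is exactly what makes the stage
   problem of the next earlier period non-degenerate. *)
Lemma stage_nondegenerate k a : 1 < a ->
  [/\ 0 < margin k a, c < margin k a + (valueM k (a + 1) - valueM k a)
    & maker_foc a c (margin k a) (valueM k (a + 1) - valueM k a) (stock k a)].
Proof.
suff inv : 1 < a ->
    0 < margin k a /\ c < margin k a + (valueM k (a + 1) - valueM k a).
  by move=> a1; have [h1 h2] := inv a1; split => //; exact: foc_rootP.
elim: k a => [|k IH] a a1.
  rewrite /margin /valueR /valueM /= !subr0 !addr0.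
  by split => //; exact: lt_trans cp.
have focP b : 1 < b -> maker_foc b c (margin k b)
    (valueM k (b + 1) - valueM k b) (stock k b).
  by move=> b1; have [h1 h2] := IH _ b1; exact: foc_rootP.
have a1' : 1 < a + 1 by rewrite ltr_wpDr.
have [r0 _] := IH _ a1; have [r0' _] := IH _ a1'.
have foc := focP _ a1; have foc' := focP _ a1'.
have [U1 _] := foc; have [U1' _] := foc'.
have gR := retailer_gain_gt0 a1' r0' U1'.
have gM := maker_gain_gt0 c0 a1' r0' foc'.
move: gR gM; rewrite retailer_gain_foc// maker_gain_foc// -!/(price _ _).
rewrite {2}/margin !valueRS !valueMS /margin !valueRS.
have w0 : 0 < price k a.
  by rewrite /price mulr_gt0// powR_gt0// (lt_trans _ U1).
have az : 0 < a * (stock k a - 1).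
  by rewrite mulr_gt0 ?subr_gt0// (lt_trans _ a1).
have waz := mulr_gt0 w0 az; have caz := mulr_gt0 c0 az.
move: w0 waz caz; rewrite /margin.
(* With [w = price k a] and [z = stock k a - 1], the terms at [a + 1] cancel: the new margin is the
   retailer's gain at [a + 1] plus [w (1 + a z)], and adding the manufacturer's increment gives [c]
   plus both gains plus [(w + c) a z]. *)
by split; lra.
Qed.

(** The recursion is written relative to the state [a + 1], which suits the sums; this form relative
    to [a] matches the stage objective. *)
Lemma valueRS_gain k a : 1 < a -> valueR k.+1 a =
  valueR k a + retailer_gain a (margin k a) (price k a) (stock k a).
Proof.
move=> a1; have [r0 _ [U1 _]] := stage_nondegenerate k a1.
rewrite valueRS retailer_gain_foc// -/(price k a) /margin; ring.
Qed.

Lemma valueMS_gain k a : 1 < a -> valueM k.+1 a = valueM k a +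
  maker_gain a c (margin k a) (valueM k (a + 1) - valueM k a) (stock k a).
Proof.
move=> a1; have [r0 _ foc] := stage_nondegenerate k a1.
rewrite valueMS maker_gain_foc// -/(price k a); ring.
Qed.

Lemma price_gt0 k a : 1 < a -> 0 < price k a.
Proof.
move=> a1; have [r0 _ [U1 _]] := stage_nondegenerate k a1.
by rewrite /price mulr_gt0// powR_gt0// (lt_trans _ U1).
Qed.

Lemma best_stock_price_stock k a : 1 < a ->
  best_stock a (margin k a) (price k a) = stock k a.
Proof.
move=> a1; have [r0 _ [U1 _]] := stage_nondegenerate k a1.
by rewrite (best_stock_at_price a1 r0 U1).2.
Qed.

(** Dividing the first-order condition by [a r] shows that the bracket is the inverse of the
    stock. *)
Lemma price_fixpoint k a : 1 < a -> price k a = margin k a *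
  (1 - a^-1 + c / (a * price k a)
   - (valueM k (a + 1) - valueM k a) / (a * margin k a)) `^ a.
Proof.
move=> a1; have [r0 _ [U1 foc]] := stage_nondegenerate k a1.
have a0 : a != 0 by rewrite gt_eqF// (lt_trans _ a1).
have U0 : 0 < stock k a by rewrite (lt_trans _ U1).
have r0' : margin k a != 0 by rewrite gt_eqF.
have U0' : stock k a != 0 by rewrite gt_eqF.
have Ua : stock k a `^ a != 0 by rewrite gt_eqF// powR_gt0.
have -> : 1 - a^-1 + c / (a * price k a)
    - (valueM k (a + 1) - valueM k a) / (a * margin k a) = (stock k a)^-1.
  rewrite /price powRN.
  have -> : c / (a * (margin k a / stock k a `^ a)) =
      (c * stock k a `^ a) / (a * margin k a).
    by field; rewrite a0 r0' Ua.
  rewrite foc; field.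
  by rewrite a0 r0' U0'.
by rewrite -(powR_inv1 (ltW U0)) -powRrM mulN1r.
Qed.

End Recursion.

(** * Stage equilibria in standardized and original scale *)

Section Equilibrium.
Context {R : realType}.
Variables (p c : R).
Hypotheses (c0 : 0 < c) (cp : c < p).

Notation valueR := (valueR p c).
Notation valueM := (valueM p c).
Notation margin := (margin p c).
Notation stock := (stock p c).
Notation price := (price p c).

(** [Eop] at [a] reads a function only at [a] and [a + 1]; equilibrium values are known on the grid
    [A] alone. *)
Definition agrees (f : R -> R) (g : R -> R) (a : R) : Prop :=
  f a = g a /\ f (a + 1) = g (a + 1).

Lemma std_retailer_strict_max k a w (f : R -> R) : 1 < a -> 0 < w ->
  agrees f (valueR k) a ->
  strict_max inQ (fun z => PiRt p a w z + Eop f a z)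
    (best_stock a (margin k a) w - 1).
Proof.
move=> a1 w0 [e0 e1]; have [r0 _ _] := stage_nondegenerate c0 cp k a1.
by have := @retailer_strict_max R p a w f a1 w0; rewrite e0 e1; exact.
Qed.

Lemma std_maker_strict_max k a (f : R -> R) (z : R -> R) : 1 < a ->
  agrees f (valueM k) a ->
  (forall w, inW w -> z w = best_stock a (margin k a) w - 1) ->
  strict_max inW (fun w => PiMt c a w (z w) + Eop f a (z w)) (price k a).
Proof.
move=> a1 [e0 e1] zE; have [r0 _ foc] := stage_nondegenerate c0 cp k a1.
by apply: maker_strict_max => //; rewrite e0 e1.
Qed.

Lemma std_retailer_value k a (f : R -> R) z : 1 < a -> agrees f (valueR k) a ->
  z = best_stock a (margin k a) (price k a) - 1 ->
  PiRt p a (price k a) z + Eop f a z = valueR k.+1 a.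
Proof.
move=> a1 [e0 e1] ->.
rewrite retailer_objective// ?subr_ge0 ?best_stock_ge1// e0 e1 valueRS_gain//.
by rewrite [1 + (_ - 1)]addrC subrK best_stock_price_stock.
Qed.

Lemma std_maker_value k a (f : R -> R) z : 1 < a -> agrees f (valueM k) a ->
  z = best_stock a (margin k a) (price k a) - 1 ->
  PiMt c a (price k a) z + Eop f a z = valueM k.+1 a.
Proof.
move=> a1 [e0 e1] ->; have [r0 _ _] := stage_nondegenerate c0 cp k a1.
rewrite maker_objective ?price_gt0// e0 e1 valueMS_gain//.
by rewrite best_stock_price_stock.
Qed.

(* The belief scale [b] factors out of the game: values are [b / (a - 1)] times
   the standardized ones. *)
Definition scaled (V : R -> R -> R) (f : R -> R) (a b : R) : Prop :=
  forall x, b <= x -> V a x = x / (a - 1) * f a /\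
                      V (a + 1) x = x / a * f (a + 1).

Section Scaling.
Variables (a b : R) (V : R -> R -> R) (f : R -> R).
Hypotheses (a1 : 1 < a) (b0 : 0 < b) (Vf : scaled V f a b).

Lemma Eexists_scaled q : 0 <= q -> Eexists a b (VPhi V a b q).
Proof.
by move=> q0; apply: (Eexists_VPhi (f := f)) => // x bx; have [] := Vf bx.
Qed.

Lemma Epred_scaled q : 0 <= q ->
  Epred a b (VPhi V a b q) = b / (a - 1) * Eop f a (q / b).
Proof.
by move=> q0; apply: (Epred_VPhi (f := f)) => // x bx; have [] := Vf bx.
Qed.

Lemma retailer_objective_scaled w q : 0 <= q ->
  PiR p a b w q + Epred a b (VPhi V a b q) =
  b / (a - 1) * (PiRt p a w (q / b) + Eop f a (q / b)).
Proof.
move=> q0; have qb : 0 <= q / b by rewrite divr_ge0// ltW.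
rewrite Epred_scaled// [RHS]mulrDr; congr (_ + _).
have bq : b + q != 0 by rewrite gt_eqF// ltr_wpDr.
have bn : b != 0 by rewrite gt_eqF.
have an : a - 1 != 0 by rewrite subr_eq0 gt_eqF.
rewrite /PiR /PiRt !Epred_min//.
have -> : 1 / (1 + q / b) = b / (b + q) by field; rewrite bq bn.
by field; rewrite bn an.
Qed.

Lemma maker_objective_scaled w q : 0 <= q ->
  PiM c w q + Epred a b (VPhi V a b q) =
  b / (a - 1) * (PiMt c a w (q / b) + Eop f a (q / b)).
Proof.
move=> q0; rewrite Epred_scaled// [RHS]mulrDr; congr (_ + _).
have bn : b != 0 by rewrite gt_eqF.
have an : a - 1 != 0 by rewrite subr_eq0 gt_eqF.
by rewrite /PiM /PiMt; field; rewrite bn an.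
Qed.

End Scaling.

Lemma retailer_strict_max_scaled k a b w V : 1 < a -> 0 < b -> 0 < w ->
  scaled V (valueR k) a b ->
  strict_max inQ (fun q => PiR p a b w q + Epred a b (VPhi V a b q))
    (b * (best_stock a (margin k a) w - 1)).
Proof.
move=> a1 b0 w0 Vf.
apply: (@strict_max_scale _ _ (fun z => PiRt p a w z + Eop (valueR k) a z) _ _
  (b / (a - 1))) => //.
- by rewrite divr_gt0// subr_gt0.
- by move=> y y0; rewrite /inQ mulr_ge0 ?divr_ge0// ltW.
- by move=> y y0; rewrite (retailer_objective_scaled a1 b0 Vf).
- exact: std_retailer_strict_max.
Qed.

Lemma maker_strict_max_scaled k a b V (q : R -> R) : 1 < a -> 0 < b ->
  scaled V (valueM k) a b ->
  (forall w, inW w -> q w = b * (best_stock a (margin k a) w - 1)) ->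
  strict_max inW (fun w => PiM c w (q w) + Epred a b (VPhi V a b (q w)))
    (price k a).
Proof.
(* Prices do not scale with [b], so the scaling lemma is applied with argument factor [1]. *)
move=> a1 b0 Vf qE; rewrite -[price k a]mul1r.
pose z w := best_stock a (margin k a) w - 1.
apply: (@strict_max_scale _ _ (fun w => PiMt c a w (z w) +
  Eop (valueM k) a (z w)) _ _ (b / (a - 1))) => //.
- by rewrite divr_gt0// subr_gt0.
- by move=> w w0; rewrite mul1r divr1.
- move=> w w0; rewrite divr1 qE// (maker_objective_scaled a1 b0 Vf).
    by rewrite [b * _]mulrC mulfK// gt_eqF.
  by rewrite mulr_ge0 ?subr_ge0 ?best_stock_ge1// ltW.
- exact: std_maker_strict_max.
Qed.

Lemma retailer_value_scaled k a b V q : 1 < a -> 0 < b ->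
  scaled V (valueR k) a b ->
  q = b * (best_stock a (margin k a) (price k a) - 1) ->
  PiR p a b (price k a) q + Epred a b (VPhi V a b q) =
  b / (a - 1) * valueR k.+1 a.
Proof.
move=> a1 b0 Vf ->; rewrite (retailer_objective_scaled a1 b0 Vf); last first.
  by rewrite mulr_ge0 ?subr_ge0 ?best_stock_ge1// ltW.
rewrite [b * _]mulrC mulfK ?gt_eqF//; congr (_ * _).
exact: std_retailer_value.
Qed.

Lemma maker_value_scaled k a b V q : 1 < a -> 0 < b ->
  scaled V (valueM k) a b ->
  q = b * (best_stock a (margin k a) (price k a) - 1) ->
  PiM c (price k a) q + Epred a b (VPhi V a b q) =
  b / (a - 1) * valueM k.+1 a.
Proof.
move=> a1 b0 Vf ->; rewrite (maker_objective_scaled a1 b0 Vf); last first.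
  by rewrite mulr_ge0 ?subr_ge0 ?best_stock_ge1// ltW.
rewrite [b * _]mulrC mulfK ?gt_eqF//; congr (_ * _).
exact: std_maker_value.
Qed.

(** * Uniqueness by backward induction *)

Lemma inA_gt1 (a1 a : R) : 1 < a1 -> inA a1 a -> 1 < a.
Proof. by move=> a11 [n ->]; rewrite ltr_wpDr. Qed.

Lemma inA_succ (a1 a : R) : inA a1 a -> inA a1 (a + 1).
Proof. by move=> [n ->]; exists n.+1; rewrite -addrA -natr1. Qed.

(** The retailer's response is identified first, at every price, because the manufacturer's
    objective is determined only then. Strictness forces both choices, and the attained maxima give
    the values. *)
Lemma SMPS_step T a1 w z fR fM fRh t k : 1 < a1 -> (1 <= t <= T)%N ->
  SMPS_with T p c a1 w z fR fM fRh ->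
  (forall a, inA a1 a -> fR t.+1 a = valueR k a /\ fM t.+1 a = valueM k a) ->
  forall a, inA a1 a ->
  [/\ w t a = price k a,
      forall w0, inW w0 -> z t a w0 = best_stock a (margin k a) w0 - 1,
      fR t a = valueR k.+1 a & fM t a = valueM k.+1 a].
Proof.
move=> a11 tT [_ hz hw hf] IH a aA.
have a1' := inA_gt1 a11 aA.
have [eR0 eM0] := IH _ aA; have [eR1 eM1] := IH _ (inA_succ aA).
have aR : agrees (fR t.+1) (valueR k) a by [].
have aM : agrees (fM t.+1) (valueM k) a by [].
have zE w0 : inW w0 -> z t a w0 = best_stock a (margin k a) w0 - 1.
  move=> w00.
  exact: (strict_max_uniq (std_retailer_strict_max a1' w00 aR)
    (hz _ _ _ tT aA w00)).1.
have [wE fME] := strict_max_uniq (std_maker_strict_max a1' aM zE) (hw _ _ tT aA).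
have p0 := price_gt0 c0 cp k a1'.
split => //.
- rewrite hf// wE; have [_ -> _] := hz _ _ _ tT aA p0.
  by apply: std_retailer_value => //; exact: zE.
- by rewrite fME; apply: std_maker_value => //; exact: zE.
Qed.

Lemma SMPS_values T a1 w z fR fM fRh : 1 < a1 ->
  SMPS_with T p c a1 w z fR fM fRh ->
  forall k t, (1 <= t)%N -> (t + k = T.+1)%N ->
  forall a, inA a1 a -> fR t a = valueR k a /\ fM t a = valueM k a.
Proof.
move=> a11 E; elim=> [|k IH] t t1.
  rewrite addn0 => -> a aA; have [h _ _ _] := E.
  (* The terminal condition is stated for every admissible price; the price [1] serves. *)
  by have [-> -> _] := h _ _ aA ltr01.
rewrite addnS => -[tk] a aA.
have tT : (1 <= t <= T)%N by rewrite t1 -tk leq_addr.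
have tk' : (t.+1 + k = T.+1)%N by rewrite addSn tk.
by have [_ _ -> ->] := SMPS_step a11 tT E (IH _ (ltn0Sn _) tk') aA.
Qed.

Lemma MPE_step T a1 b1 w q VR VM VRh t k : 1 < a1 -> 0 < b1 ->
  (1 <= t <= T)%N -> MPE_with T p c a1 b1 w q VR VM VRh ->
  (forall a b, inA a1 a -> inB b1 b ->
     VR t.+1 a b = b / (a - 1) * valueR k a /\
     VM t.+1 a b = b / (a - 1) * valueM k a) ->
  forall a b, inA a1 a -> inB b1 b ->
  [/\ w t a b = price k a,
      forall w0, inW w0 ->
        q t a b w0 = b * (best_stock a (margin k a) w0 - 1),
      VR t a b = b / (a - 1) * valueR k.+1 a &
      VM t a b = b / (a - 1) * valueM k.+1 a].
Proof.
move=> a11 b10 tT [_ _ hq hw hV] IH a b aA bB.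
have a1' := inA_gt1 a11 aA.
have b0 : 0 < b by exact: lt_le_trans bB.
(* Beliefs only move upward from [b] and [B] is upward closed, so the induction hypothesis covers
   every reachable state. *)
have sR : scaled (VR t.+1) (valueR k) a b.
  move=> x bx; have xB : inB b1 x by exact: le_trans bx.
  have [-> _] := IH _ _ aA xB; have [-> _] := IH _ _ (inA_succ aA) xB.
  by rewrite addrK.
have sM : scaled (VM t.+1) (valueM k) a b.
  move=> x bx; have xB : inB b1 x by exact: le_trans bx.
  have [_ ->] := IH _ _ aA xB; have [_ ->] := IH _ _ (inA_succ aA) xB.
  by rewrite addrK.
have qE w0 : inW w0 -> q t a b w0 = b * (best_stock a (margin k a) w0 - 1).
  move=> w00; have [_ hm] := hq _ _ _ _ tT aA bB w00.
  exact: (strict_max_uniq (retailer_strict_max_scaled a1' b0 w00 sR) hm).1.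
have [_ hm] := hw _ _ _ tT aA bB.
have [wE VME] := strict_max_uniq (maker_strict_max_scaled a1' b0 sM qE) hm.
have p0 := price_gt0 c0 cp k a1'.
split => //.
- rewrite hV// wE; have [_ [_ -> _]] := hq _ _ _ _ tT aA bB p0.
  by apply: retailer_value_scaled => //; exact: qE.
- by rewrite VME; apply: maker_value_scaled => //; exact: qE.
Qed.

Lemma MPE_values T a1 b1 w q VR VM VRh : 1 < a1 -> 0 < b1 ->
  MPE_with T p c a1 b1 w q VR VM VRh ->
  forall k t, (1 <= t)%N -> (t + k = T.+1)%N ->
  forall a b, inA a1 a -> inB b1 b ->
    VR t a b = b / (a - 1) * valueR k a /\ VM t a b = b / (a - 1) * valueM k a.
Proof.
move=> a11 b10 E; elim=> [|k IH] t t1.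
  rewrite addn0 => -> a b aA bB; have [_ h _ _ _] := E.
  by have [-> -> _] := h _ _ _ aA bB ltr01; rewrite mulr0.
rewrite addnS => -[tk] a b aA bB.
have tT : (1 <= t <= T)%N by rewrite t1 -tk leq_addr.
have tk' : (t.+1 + k = T.+1)%N by rewrite addSn tk.
by have [_ _ -> ->] := MPE_step a11 b10 tT E (IH _ (ltn0Sn _) tk') aA bB.
Qed.

(** * Measurability and closed forms *)

Lemma best_stockB1 (a r w : R) :
  best_stock a r w - 1 = Num.max ((r / w) `^ a^-1 - 1) 0.
Proof.
by rewrite /best_stock !maxEle subr_le0; case: ifP => // _; rewrite subrr.
Qed.

(** For positive prices [(r / w)^(1/a)] splits as [r^(1/a) w^(-1/a)], a measurable power of the
    price. *)
Lemma measurable_order (a r : R) (B : set R) : 0 < r ->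
  measurable_fun (B `*` inW)
    (fun bw : R * R => bw.1 * (best_stock a r bw.2 - 1)).
Proof.
move=> r0; apply: (@eq_measurable_fun _ _ _ _ _ (fun bw : R * R =>
  bw.1 * (Num.max (r `^ a^-1 * bw.2 `^ (- a^-1)) 1 - 1))).
  move=> [b w]; rewrite inE => -[/= _ w0].
  rewrite /best_stock powRM ?invr_ge0 ?ltW//.
  by rewrite -(powR_inv1 (ltW w0)) -powRrM mulN1r.
apply: measurable_funTS; apply: measurable_funM; first exact: measurable_fst.
apply: measurable_funB => //; apply: measurable_maxr => //.
apply: measurable_funM => //.
exact: (measurableT_comp (measurable_powR (- a^-1)) measurable_snd).
Qed.

(** Unrolls the recursion along the diagonal: each step raises the state by one and shortens the
    horizon by one. *)
Lemma valueR_sum k a : valueR k a = \sum_(0 <= i < k)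
  (p - price (k.-1 - i) (a + i%:R) *
       (1 + (a + i%:R) * (stock (k.-1 - i) (a + i%:R) - 1))).
Proof.
elim: k a => [|k IH] a; first by rewrite big_geq.
rewrite big_nat_recl// addr0 subn0 valueRS IH; congr (_ + _).
apply: eq_bigr => i _.
have -> : (k.+1.-1 - i.+1 = k.-1 - i)%N by rewrite /= subnS -subn1 subnAC subn1.
by rewrite -addrA nat1r.
Qed.

Lemma valueM_sum k a : valueM k a = \sum_(0 <= i < k)
  (price (k.-1 - i) (a + i%:R)
   - c * (1 + (a + i%:R) * (stock (k.-1 - i) (a + i%:R) - 1))).
Proof.
elim: k a => [|k IH] a; first by rewrite big_geq.
rewrite big_nat_recl// addr0 subn0 valueMS IH; congr (_ + _).
apply: eq_bigr => i _.
have -> : (k.+1.-1 - i.+1 = k.-1 - i)%N by rewrite /= subnS -subn1 subnAC subn1.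
by rewrite -addrA nat1r.
Qed.

End Equilibrium.

(** * Existence, uniqueness and closed forms assembled *)

Theorem theorem2 (R : realType) (p c : R) (T : nat) (a1 b1 : R) :
  0 < c -> c < p -> (1 <= T)%N -> 0 < b1 -> 1 < a1 ->
  exists (w : nat -> R -> R) (z : nat -> R -> R -> R)
         (fR fM : nat -> R -> R) (fRh : nat -> R -> R -> R),
  [/\
   (* (a) existence of an SMPS, with its standardized value functions *)
   SMPS_with T p c a1 w z fR fM fRh,
   (* (a) uniqueness of the SMPS *)
   (forall (w' : nat -> R -> R) (z' : nat -> R -> R -> R),
      SMPS T p c a1 w' z' ->
      forall t a w0, (1 <= t <= T)%N -> inA a1 a -> inW w0 ->
        w' t a = w t a /\ z' t a w0 = z t a w0),
   (* (a) closed forms of the strategies *)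
   (forall t a w0, (1 <= t <= T)%N -> inA a1 a -> inW w0 ->
      [/\ w t a = (p + fR t.+1 (a + 1) - fR t.+1 a) *
            (1 - a^-1 + c / (a * w t a)
             - (fM t.+1 (a + 1) - fM t.+1 a)
               / (a * (p + fR t.+1 (a + 1) - fR t.+1 a))) `^ a,
          z t a w0 = Num.max (((p + fR t.+1 (a + 1) - fR t.+1 a) / w0) `^ (a^-1) - 1) 0 &
          z t a (w t a) = ((p + fR t.+1 (a + 1) - fR t.+1 a) / w t a) `^ (a^-1) - 1]),
   (* (a) closed forms of the standardized value functions *)
   (forall t a, (1 <= t <= T)%N -> inA a1 a ->
      fR t a = \sum_(0 <= i < (T - t).+1)
                 (p - w (t + i)%N (a + i%:R)
                      * (1 + (a + i%:R) * z (t + i)%N (a + i%:R) (w (t + i)%N (a + i%:R))))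
      /\
      fM t a = \sum_(0 <= i < (T - t).+1)
                 (w (t + i)%N (a + i%:R)
                  - c * (1 + (a + i%:R) * z (t + i)%N (a + i%:R) (w (t + i)%N (a + i%:R))))) &
   (* (b) the MPE: existence and uniqueness *)
   MPE T p c a1 b1 (fun t a b => w t a) (fun t a b w0 => b * z t a w0) /\
   (forall (w' : nat -> R -> R -> R) (q' : nat -> R -> R -> R -> R),
      MPE T p c a1 b1 w' q' ->
      forall t a b w0, (1 <= t <= T)%N -> inA a1 a -> inB b1 b -> inW w0 ->
        w' t a b = w t a /\ q' t a b w0 = b * z t a w0)].
Proof.
move=> c0 cp T1 b10 a11.
pose w t a := price p c (T - t) a.
pose z t a w0 := best_stock a (margin p c (T - t) a) w0 - 1.
pose fR t a := valueR p c (T.+1 - t) a.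
pose fM t a := valueM p c (T.+1 - t) a.
(* At [t = T + 1] the truncated subtraction [T - t] would still describe a stage with trade, so the
   terminal zero is imposed by cases. *)
pose fRh t a w0 := if (t <= T)%N
  then PiRt p a w0 (z t a w0) + Eop (fR t.+1) a (z t a w0) else 0.
have aA1 a : inA a1 a -> 1 < a by exact: inA_gt1.
have valS t : (1 <= t <= T)%N -> (T.+1 - t = (T - t).+1)%N.
  by move=> /andP[_ tT]; rewrite subSn.
have zE t a : inA a1 a -> z t a (w t a) = stock p c (T - t) a - 1.
  by move=> /aA1 h; rewrite /z /w best_stock_price_stock.
(* [T.+1 - t.+1] computes to [T - t], so the continuation values at [t] are definitionally those of
   the recursion. *)
have agR t a : agrees (fR t.+1) (valueR p c (T - t)) a by [].
have agM t a : agrees (fM t.+1) (valueM p c (T - t)) a by [].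
exists w, z, fR, fM, fRh; split.
- split.
  + by move=> a w0 aA w00; rewrite /fR /fM /fRh subnn ltnn.
  + move=> t a w0 /andP[_ tT] /aA1 h w00; rewrite /fRh tT.
    exact: strict_max_is_max (std_retailer_strict_max c0 cp h w00 (agR t a)).
  + move=> t a tT /aA1 h.
    rewrite /fM (valS _ tT) -(std_maker_value c0 cp h (agM t a) erefl).
    exact: strict_max_is_max
      (std_maker_strict_max (z := z t a) c0 cp h (agM t a) _).
  + move=> t a tT /aA1 h; have /andP[_ tT'] := tT.
    rewrite /fRh tT' /fR (valS _ tT).
    by rewrite -(std_retailer_value c0 cp h (agR t a) erefl).
- move=> w' z' [fR' [fM' [fRh' E]]] t a w0 tT aA w00.
  have /andP[t1 tT'] := tT.
  have tk : (t.+1 + (T - t) = T.+1)%N by rewrite addSn subnKC.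
  have [-> zE' _ _] := SMPS_step c0 cp a11 tT E
    (SMPS_values c0 cp a11 E (ltn0Sn _) tk) aA.
  by rewrite zE'.
- move=> t a w0 tT aA w00; split.
  + exact: (price_fixpoint c0 cp (T - t) (aA1 _ aA)).
  + exact: best_stockB1.
  (* On the equilibrium path the stock exceeds [1], so the maximum with zero drops out. *)
  + rewrite zE//.
    have [r0 _ [U1 _]] := stage_nondegenerate c0 cp (T - t) (aA1 _ aA).
    congr (_ - 1); symmetry.
    exact: (best_stock_at_price (aA1 _ aA) r0 U1).1.
- move=> t a tT aA; rewrite /fR /fM (valS _ tT) valueR_sum valueM_sum.
  have inA_add i : inA a1 (a + i%:R).
    by have [n ->] := aA; exists (n + i)%N; rewrite natrD addrA.
  by split; apply: eq_bigr => i _; rewrite zE// /w subnDA.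
- split.
  + exists (fun t a b => b / (a - 1) * fR t a),
      (fun t a b => b / (a - 1) * fM t a),
      (fun t a b w0 => b / (a - 1) * fRh t a w0).
    have scR t a b : scaled (fun a b => b / (a - 1) * fR t.+1 a)
        (valueR p c (T - t)) a b by move=> x _; rewrite addrK.
    have scM t a b : scaled (fun a b => b / (a - 1) * fM t.+1 a)
        (valueM p c (T - t)) a b by move=> x _; rewrite addrK.
    have b0 b : inB b1 b -> 0 < b by exact: lt_le_trans.
    split.
    * move=> t a tT aA; split; first exact: measurable_cst.
      have [r0 _ _] := stage_nondegenerate c0 cp (T - t) (aA1 _ aA).
      exact: measurable_order.
    * move=> a b w0 aA bB w00.
      by rewrite /fR /fM /fRh subnn ltnn /= !mulr0.
    * move=> t a b w0 /andP[_ tT] /aA1 h /b0 bp w00; split.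
        by move=> q0 q00; exact: Eexists_scaled (scR t a b) _ q00.
      have S := retailer_strict_max_scaled c0 cp h bp w00 (scR t a b).
      have := strict_max_is_max S.
      rewrite /= (retailer_objective_scaled p h bp (scR t a b)); last exact: S.1.
      by rewrite /fRh tT [b * (_ - 1)]mulrC mulfK ?gt_eqF.
    * move=> t a b tT /aA1 h /b0 bp; split.
        move=> w0 w00; apply: Eexists_scaled (scM t a b) _ _ => //.
        by rewrite mulr_ge0 ?subr_ge0 ?best_stock_ge1// ltW.
      have S := maker_strict_max_scaled (q := fun w0 => b * z t a w0)
        c0 cp h bp (scM t a b) (fun _ _ => erefl).
      have := strict_max_is_max S.
      by rewrite /= (maker_value_scaled c0 cp h bp (scM t a b) erefl) /fM (valS _ tT).
    * move=> t a b tT /aA1 h bB; have /andP[_ tT'] := tT.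
      rewrite /fRh tT' /fR (valS _ tT).
      by rewrite -(std_retailer_value c0 cp h (agR t a) erefl).
  + move=> w' q' [VR' [VM' [VRh' E]]] t a b w0 tT aA bB w00.
    have /andP[t1 tT'] := tT.
    have tk : (t.+1 + (T - t) = T.+1)%N by rewrite addSn subnKC.
    have [-> qE' _ _] := MPE_step c0 cp a11 b10 tT E
      (MPE_values c0 cp a11 b10 E (ltn0Sn _) tk) aA bB.
    by rewrite qE'.
Qed.
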